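(* Let $F$ be an algebraically closed field and $s$ a positive integer. If an $s$-dimensional subspace $S_s$ of $\mathrm{PG}(2s-1,F)$ meets all $S^I\in\mathcal{S}_{s-1,1,F}^I$ only in points (i.e. $S_s\cap S^I$ is a single point for every $S^I\in\mathcal{S}_{s-1,1,F}^I$), then such points span $S_s$.
   Context: All dimensions are projective. The Segre variety $\mathcal{S}_{s-1,1,F}$ in $\mathrm{PG}(2s-1,F)$ is the image of the Segre embedding of $\mathrm{PG}(s-1,F)\times\mathrm{PG}(1,F)$; $\mathcal{S}_{s-1,1,F}^I$ is its family of $(s-1)$-dimensional maximal subspaces that are the images of $\mathrm{PG}(s-1,F)\times\{y\}$, $y\in\mathrm{PG}(1,F)$. *)

(* Defs.v *)
From HB Require Import structures.
From mathcomp Require Import all_boot all_order all_algebra.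

Set Implicit Arguments.
Unset Strict Implicit.
Unset Printing Implicit Defensive.

Import GRing.Theory.
Local Open Scope ring_scope.

(* PG(n - 1, F) is the lattice of subspaces of 'rV[F]_n; a projective subspace
   of dimension d is a vector subspace of dimension d.+1. *)
Definition pdim_is (F : fieldType) (V : vectType F) (d : nat) (U : {vspace V})
  : Prop := \dim U = d.+1.

Definition is_point (F : fieldType) (V : vectType F) (p : {vspace V}) : Prop :=
  pdim_is 0 p.

(* U is the least subspace containing all the elements of the family X. *)
Definition is_pspan (F : fieldType) (V : vectType F)
    (X : {vspace V} -> Prop) (U : {vspace V}) : Prop :=
  (forall p, X p -> (p <= U)%VS) /\
  (forall W : {vspace V}, (forall p, X p -> (p <= W)%VS) -> (U <= W)%VS).

(* The Segre embedding ([x], [y]) |-> [x_i y_j]. *)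
Definition segre_vec (F : fieldType) (m n : nat) (x : 'rV[F]_m) (y : 'rV[F]_n)
  : 'rV[F]_(m * n) := mxvec (x^T *m y).

(* On points, vpick selects a nonzero representative; segre_line below shows
   that its choice is irrelevant. *)
Definition segre (F : fieldType) (m n : nat)
    (p : {vspace 'rV[F]_m}) (q : {vspace 'rV[F]_n}) : {vspace 'rV[F]_(m * n)} :=
  <[segre_vec (vpick p) (vpick q)]>%VS.

(* W is the image of PG(s - 1, F) x {q} for some point q of PG(1, F). *)
Definition segreI (F : fieldType) (s : nat) (W : {vspace 'rV[F]_(s * 2)})
  : Prop :=
  exists q : {vspace 'rV[F]_2}, is_point q /\
    forall r : {vspace 'rV[F]_(s * 2)}, is_point r ->
      ((r <= W)%VS <->
       exists p : {vspace 'rV[F]_s}, is_point p /\ r = segre p q).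

Section Facts.
Variable F : fieldType.

Lemma is_pointP (V : vectType F) (p : {vspace V}) :
  is_point p <-> exists2 v, v != 0 & p = <[v]>%VS.
Proof.
split=> [p1|[v v0 ->]]; last by rewrite /is_point /pdim_is dim_vline v0.
have v0 : vpick p != 0 by rewrite vpick0 -dimv_eq0 p1.
exists (vpick p) => //; apply/eqP.
by rewrite eq_sym eqEdim dim_vline v0 p1 -memvE memv_pick.
Qed.

Lemma segre_vecZl m n (a : F) (x : 'rV_m) (y : 'rV_n) :
  segre_vec (a *: x) y = a *: segre_vec x y.
Proof. by rewrite /segre_vec linearZ -scalemxAl linearZ. Qed.

Lemma segre_vecZr m n (a : F) (x : 'rV_m) (y : 'rV_n) :
  segre_vec x (a *: y) = a *: segre_vec x y.
Proof. by rewrite /segre_vec -scalemxAr linearZ. Qed.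

Lemma segre_vecDl m n (x x' : 'rV[F]_m) (y : 'rV_n) :
  segre_vec (x + x') y = segre_vec x y + segre_vec x' y.
Proof. by rewrite /segre_vec linearD mulmxDl linearD. Qed.

Lemma segre_vec_eq0 m n (x : 'rV[F]_m) (y : 'rV[F]_n) :
  (segre_vec x y == 0) = (x == 0) || (y == 0).
Proof.
apply/idP/idP=> [|/orP[] /eqP->]; last 2 first.
- by rewrite /segre_vec trmx0 mul0mx linear0.
- by rewrite /segre_vec mulmx0 linear0.
rewrite /segre_vec mxvec_eq0 => /eqP/matrixP xy0.
case: eqVneq => //= /eqP x0; apply/eqP/rowP=> j; rewrite mxE.
apply/eqP; apply: contra_notT x0 => yj; apply/rowP=> i; rewrite mxE.
have := xy0 i j; rewrite !mxE big_ord1 mxE => /eqP.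
by rewrite mulf_eq0 (negPf yj) orbF => /eqP.
Qed.

Lemma vpick_line (V : vectType F) (v : V) :
  v != 0 -> exists2 a, a != 0 & vpick <[v]>%VS = a *: v.
Proof.
move=> v0; have /vlineP[a e] := memv_pick <[v]>%VS.
exists a => //; apply: contraNneq v0 => a0.
have : vpick <[v]>%VS == 0 by rewrite e a0 scale0r.
by rewrite vpick0 -dimv_eq0 dim_vline eqb0 negbK.
Qed.

Lemma vlineZ (V : vectType F) (a : F) (v : V) :
  a != 0 -> <[a *: v]>%VS = <[v]>%VS.
Proof.
move=> a0; apply/eqP; rewrite eqEsubv -!memvE memvZ ?memv_line //=.
by apply/vlineP; exists a^-1; rewrite scalerA mulVf ?scale1r.
Qed.

Lemma segre_line m n (x : 'rV[F]_m) (y : 'rV[F]_n) :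
  x != 0 -> y != 0 -> segre <[x]>%VS <[y]>%VS = <[segre_vec x y]>%VS.
Proof.
move=> /vpick_line[a a0 ea] /vpick_line[b b0 eb].
by rewrite /segre ea eb segre_vecZl segre_vecZr !vlineZ.
Qed.

(* The members of segreI are the subspaces F^s (x) y, for y != 0. *)
Lemma segreIP s (W : {vspace 'rV[F]_(s * 2)}) :
  segreI W <-> exists2 y : 'rV[F]_2, y != 0 &
    forall v, (v \in W) <-> exists x, v = segre_vec x y.
Proof.
split=> [[q [/is_pointP[y y0 ->] Wq]]|[y y0 Wy]].
  exists y => // v; case: (eqVneq v 0) => [->|v0].
    split=> [_|_]; last exact: mem0v.
    by exists 0; apply/esym/eqP; rewrite segre_vec_eq0 eqxx.
  have pv : is_point <[v]>%VS by apply/is_pointP; exists v.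
  have := Wq _ pv; rewrite -memvE => Wv; apply: (iff_trans Wv); split.
    move=> [p [/is_pointP[x x0 ->]]]; rewrite segre_line // => e.
    have : v \in <[segre_vec x y]>%VS by rewrite -e memv_line.
    by move=> /vlineP[a ->]; exists (a *: x); rewrite segre_vecZl.
  move=> [x e]; have x0 : x != 0.
    by move: v0; rewrite e segre_vec_eq0 negb_or => /andP[].
  by exists <[x]>%VS; split; [apply/is_pointP; exists x|rewrite segre_line ?e].
exists <[y]>%VS; split; first by apply/is_pointP; exists y.
move=> r /is_pointP[v v0 ->]; rewrite -memvE; apply: (iff_trans (Wy v)); split.
  move=> [x e]; have x0 : x != 0.
    by move: v0; rewrite e segre_vec_eq0 negb_or => /andP[].
  by exists <[x]>%VS; split; [apply/is_pointP; exists x|rewrite segre_line ?e].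
move=> [p [/is_pointP[x x0 ->]]]; rewrite segre_line // => e.
have : v \in <[segre_vec x y]>%VS by rewrite -e memv_line.
by move=> /vlineP[a ->]; exists (a *: x); rewrite segre_vecZl.
Qed.

Lemma segreI_exists s (y : 'rV[F]_2) : y != 0 ->
  exists W : {vspace 'rV[F]_(s * 2)}, [/\ segreI W, \dim W = s &
    forall v, (v \in W) <-> exists x, v = segre_vec x y].
Proof.
move=> y0.
have lin : linear (fun x : 'rV[F]_s => segre_vec x y).
  by move=> a u v; rewrite segre_vecDl segre_vecZl.
pose L := GRing.isLinear.Build _ _ _ _ (fun x : 'rV[F]_s => segre_vec x y) lin.
pose f : {linear 'rV[F]_s -> 'rV[F]_(s * 2)} :=
  HB.pack (fun x : 'rV[F]_s => segre_vec x y) L.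
have fE x : linfun f x = segre_vec x y by rewrite lfunE.
have Wy v : (v \in limg (linfun f)) <-> exists x, v = segre_vec x y.
  split=> [/memv_imgP[x _ ->]|[x ->]]; first by exists x.
  by rewrite -fE memv_img ?memvf.
exists (limg (linfun f)); split=> //; first by apply/segreIP; exists y.
rewrite limg_dim_eq ?dimvf /dim /= ?mul1n //.
apply/eqP; rewrite capfv -subv0; apply/subvP=> x; rewrite memv_ker fE memv0.
by rewrite segre_vec_eq0 (negPf y0) orbF.
Qed.

End Facts.

(* Main.v *)
Require Import Defs.
From HB Require Import structures.
From mathcomp Require Import all_boot all_order all_algebra.

Set Implicit Arguments.
Unset Strict Implicit.

Local Open Scope ring_scope.

Import GRing.Theory.

(** Put s = r + 1 and let y run over the nonzero vectors of F^2.  The subspace U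
    of F^s (x) F^2 has codimension r, so it is cut out by r linear forms, and
    [x (x) y] lies in U iff x M(y) = 0, where M(y) is an s x r matrix that is
    linear in y: a pencil.  Since U meets every F^s (x) y in one point, the
    kernel of M(y) is a line, so M(y) has full column rank for EVERY y; this
    includes the point at infinity of PG(1, F).

    Let phi be a linear form that vanishes at all the points U meets F^s (x) y.
    It restricts to columns P(y), also linear in y, which vanish on the kernel
    of M(y); hence P(y) = M(y) c(y) with a unique column c(y).  As a function of
    y, c is regular everywhere on the projective line, so it is constant.  Then
    phi is the combination, with coefficients c, of the forms that define U, and
    so phi vanishes on U.  As this holds for every phi that vanishes on a
    subspace containing all the points, the points span U.

    The regularity argument is made with polynomials in the affine coordinate t
    of y = (1, t).  The square matrix [P(t) | M(t)] is singular for all t, hence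
    over F[t], which gives M c = e P with e a nonzero polynomial.  The roots of
    e can be cancelled one at a time because M is injective at each of them
    ([divide_solution]); F being algebraically closed, e disappears altogether.
    Injectivity at infinity then bounds the degree of c by 0
    ([pencil_solution_const]). *)

(** * Matrices of polynomials and their values *)

Section PolyMatrix.
Variable F : closedFieldType.
Implicit Types t : F.

Notation ev t := (map_mx (horner_eval t)).

Lemma evM m n p t (A : 'M[{poly F}]_(m, n)) (B : 'M_(n, p)) :
  ev t (A *m B) = ev t A *m ev t B.
Proof. exact: map_mxM. Qed.

Lemma evZ m n t p (A : 'M[{poly F}]_(m, n)) : ev t (p *: A) = p.[t] *: ev t A.
Proof. by apply/matrixP=> i j; rewrite !mxE /horner_eval hornerM. Qed.

Lemma poly_eval0 (p : {poly F}) : (forall t, p.[t] = 0) -> p = 0.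
Proof.
move=> p0; apply/eqP; apply: contraT => /closed_nonrootP[t].
by rewrite /root p0 eqxx.
Qed.

Lemma ev_inj0 m n (A : 'M[{poly F}]_(m, n)) : (forall t, ev t A = 0) -> A = 0.
Proof.
move=> A0; apply/matrixP=> i j; rewrite mxE; apply: poly_eval0 => t.
by have /matrixP/(_ i j) := A0 t; rewrite !mxE.
Qed.

Lemma ev0_factor m n t (A : 'M[{poly F}]_(m, n)) :
  ev t A = 0 -> exists A', A = ('X - t%:P) *: A'.
Proof.
move=> A0; exists (map_mx (fun p => p %/ ('X - t%:P)) A).
apply/matrixP=> i j; rewrite !mxE mulrC divpK // dvdp_XsubCl /root.
by have /matrixP/(_ i j) := A0; rewrite !mxE /horner_eval => ->.
Qed.

(** At a root t of e, the value of M c is 0, hence c(t) = 0 and both sides are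
    divisible by 'X - t.  Algebraic closure makes e a constant in the end. *)
Lemma divide_solution m n (M : 'M[{poly F}]_(m, n)) (P : 'cV_m) :
    (forall t (c : 'cV_n), ev t M *m c = 0 -> c = 0) ->
  forall (e : {poly F}) (c : 'cV_n), e != 0 -> M *m c = e *: P ->
  exists c', M *m c' = P.
Proof.
move=> Minj e; have [k] := ubnP (size e).
elim: k e => // k IHk e lek c e0 Mc.
have [/eqP/size_poly1P[a a0 ea]|se] := eqVneq (size e) 1%N.
  exists (a^-1%:P *: c).
  by rewrite -scalemxAr Mc ea scalerA -polyCM mulVf // scale1r.
have /closed_rootP[t et] := se.
have ct : ev t c = 0.
  by apply: (Minj t); rewrite -evM Mc evZ (rootP et) scale0r.
have [c' cE] := ev0_factor ct.
have /factor_theorem[e' eE] := et.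
have X0 : 'X - t%:P != 0 :> {poly F} by rewrite polyXsubC_eq0.
have e'0 : e' != 0 by apply: contraNneq e0 => e'0; rewrite eE e'0 mul0r.
apply: (IHk e' _ c' e'0).
  by move: lek; rewrite eE size_Mmonic ?monicXsubC // size_XsubC addn2.
have /matrixP XMc : ('X - t%:P) *: (M *m c') = ('X - t%:P) *: (e' *: P).
  by rewrite scalemxAr -cE Mc eE scalerA mulrC.
apply/matrixP=> i j; have := XMc i j.
by rewrite !mxE => /(mulfI X0).
Qed.

(** * Pencils of full column rank *)

Definition pencil m n (A B : 'M[F]_(m, n)) : 'M[{poly F}]_(m, n) :=
  map_mx polyC A + 'X *: map_mx polyC B.

Lemma ev_pencil m n t (A B : 'M[F]_(m, n)) : ev t (pencil A B) = A + t *: B.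
Proof.
apply/matrixP=> i j.
by rewrite !mxE /horner_eval hornerD hornerM hornerX !hornerC.
Qed.

Notation coefm k := (map_mx (coefp k)).

Lemma coef_pencilM m n (A B : 'M[F]_(m, n)) (c : 'cV_n) k :
  coefm k (pencil A B *m c) =
  A *m coefm k c + (if k is k'.+1 then B *m coefm k' c else 0).
Proof.
rewrite /pencil mulmxDl -scalemxAl.
have coef_constM (D : 'M[F]_(m, n)) l :
    D *m coefm l c = coefm l (map_mx polyC D *m c).
  apply/matrixP=> i j; rewrite !mxE /= coef_sum; apply: eq_bigr => h _.
  by rewrite !mxE coefCM.
case: k => [|k]; rewrite !coef_constM; move: (_ *m c) (_ *m c) => P Q;
  by apply/matrixP=> i j; rewrite !mxE /= coefD coefXM.
Qed.

Lemma coef_pencil m n (A B : 'M[F]_(m, n)) k :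
  coefm k (pencil A B) = if k is k'.+1 then (if k' is _.+1 then 0 else B) else A.
Proof.
apply/matrixP=> i j; rewrite !mxE /= coefD coefXM !coefC.
by case: k => [|[|k]]; rewrite ?mxE ?addr0 ?add0r.
Qed.

(** B being injective says that the pencil is injective at infinity: it lets
    the top coefficient of c survive in the product, so a product of degree at
    most 1 forces c to be constant. *)
Lemma pencil_solution_const m n (A B : 'M[F]_(m, n)) (a b : 'cV_m)
    (c : 'cV_n) :
    (forall d : 'cV_n, B *m d = 0 -> d = 0) ->
    pencil A B *m c = pencil a b ->
  exists c0, A *m c0 = a /\ B *m c0 = b.
Proof.
move=> Binj Mc.
have step k : coefm k.+2 c = 0 -> coefm k.+1 c = 0.
  move=> ck; apply: Binj; have := coef_pencilM A B c k.+2.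
  by rewrite Mc coef_pencil ck mulmx0 add0r.
have c1 : coefm 1 c = 0.
  pose N := (\max_i size (c i ord0))%N.
  have : coefm N.+1 c = 0.
    apply/matrixP=> i j; rewrite !mxE /= (ord1 j) nth_default //.
    by apply/leqW/(leq_bigmax (F := fun i => size (c i ord0))).
  by elim: N => // N IHN /step.
exists (coefm 0 c); have := (coef_pencilM A B c 0, coef_pencilM A B c 1).
by rewrite Mc !coef_pencil c1 mulmx0 addr0 add0r => -[-> ->].
Qed.

(** M has more rows than columns, so some x <> 0 satisfies x M = 0; such an x
    also kills the extra column P. *)
Lemma row_mx_singular r (P : 'cV[F]_r.+1) (M : 'M[F]_(r.+1, r)) :
    (forall x : 'rV_r.+1, x *m M = 0 -> x *m P = 0) ->
  \det (row_mx P M : 'M_r.+1) = 0.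
Proof.
move=> kerM; apply/eqP/det0P.
have : kermx M != 0.
  by rewrite -mxrank_eq0 mxrank_ker subn_eq0 -ltnNge ltnS rank_leq_col.
case/rowV0Pn=> x /sub_kermxP xM x0; exists x => //.
apply: (etrans (mul_mx_row x P M)).
by rewrite xM kerM // row_mx0.
Qed.

(** An everywhere regular function on the projective line is constant:
    [a + t b] is a combination of the columns of [A + t B] for each t, and the
    coefficients turn out to be independent of t. *)
Lemma pencil_solution r (A B : 'M[F]_(r.+1, r)) (a b : 'cV[F]_r.+1) :
    (forall t (c : 'cV_r), (A + t *: B) *m c = 0 -> c = 0) ->
    (forall c : 'cV_r, B *m c = 0 -> c = 0) ->
    (forall t (x : 'rV_r.+1),
       x *m (A + t *: B) = 0 -> x *m (a + t *: b) = 0) ->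
  exists c, A *m c = a /\ B *m c = b.
Proof.
move=> ABinj Binj kerAB.
have Minj t (c : 'cV_r) : ev t (pencil A B) *m c = 0 -> c = 0.
  by rewrite ev_pencil; apply: ABinj.
suff [e [c [e0 Mc]]] : exists (e : {poly F}) (c : 'cV_r),
    e != 0 /\ pencil A B *m c = e *: pencil a b.
  have [c' Mc'] := divide_solution Minj e0 Mc.
  exact: pencil_solution_const Binj Mc'.
pose N : 'M[{poly F}]_r.+1 := row_mx (pencil a b) (pencil A B).
have detN : \det N = 0.
  apply: poly_eval0 => t; rewrite -[LHS]/(horner_eval t (\det N)) -det_map_mx.
  apply: etrans (row_mx_singular (kerAB t)).
  rewrite -!ev_pencil; congr (\det _).
  exact: (map_row_mx (horner_eval t) (pencil a b) (pencil A B)).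
have /eqP/det0P[v v0 vN] : \det N^T = 0 by rewrite det_tr.
(* The components (-e, c) of v^T give M c = e P; here e != 0 because M is
   injective over F[t], being so at every t. *)
pose u : 'cV[{poly F}]_(1 + r) := v^T.
have Nu : pencil a b *m usubmx u + pencil A B *m dsubmx u = 0.
  rewrite -mul_row_col vsubmxK -[LHS]/(N *m v^T).
  by apply: trmx_inj; rewrite trmx_mul trmxK vN trmx0.
exists (- usubmx u 0 0), (dsubmx u).
have PuE : pencil a b *m usubmx u = usubmx u 0 0 *: pencil a b.
  by rewrite {1}[usubmx u]mx11_scalar mul_mx_scalar.
rewrite PuE in Nu.
split; last by apply/eqP; rewrite scaleNr -addr_eq0 addrC Nu.
rewrite oppr_eq0; apply: contraNneq v0 => w0.
have c0 : dsubmx u = 0.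
  apply: ev_inj0 => t; apply: (Minj t); rewrite -evM.
  by move: Nu; rewrite w0 scale0r add0r => ->; rewrite map_mx0.
have : u = 0.
  rewrite -[u]vsubmxK c0 [usubmx u]mx11_scalar w0 -scalemx1 scale0r.
  exact: col_mx0.
by move=> u0; rewrite -[v]trmxK -/u u0 trmx0.
Qed.

End PolyMatrix.

(** * Linear equations of a subspace *)

Lemma vspace_equations (F : fieldType) m r (U : {vspace 'rV[F]_m}) :
    (\dim U + r = m)%N ->
  exists K : 'M[F]_(m, r), forall u, (u \in U) = (u *m K == 0).
Proof.
move=> dimU; pose b := vbasis U.
pose B := \matrix_(i < \dim U) b`_i.
have DB (D : 'rV_(\dim U)) : D *m B = \sum_i D 0 i *: b`_i.
  by rewrite mulmx_sum_row; apply: eq_bigr => i _; rewrite rowK.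
have UB u : (u \in U) = (u <= B)%MS.
  apply/idP/submxP => [Uu|[D ->]].
    exists (\row_i coord b i u); rewrite DB {1}(coord_vbasis Uu).
    by apply: eq_bigr => i _; rewrite mxE.
  rewrite DB; apply: memv_suml => i _; rewrite memvZ //.
  by rewrite vbasis_mem // mem_nth // size_tuple.
have rB : \rank B = \dim U.
  apply/eqP; rewrite -[_ == _]/(row_free B) -kermx_eq0; apply/rowV0P => D.
  move=> /sub_kermxP; rewrite DB => D0; apply/rowP=> i; rewrite mxE.
  by have /freeP/(_ (D 0)) := basis_free (vbasisP U); apply.
have rK : \rank (cokermx B) = r by rewrite mxrank_coker rB -{1}dimU addKn.
suff [K KE] : exists K : 'M_(m, \rank (cokermx B)),
    forall u, (u \in U) = (u *m K == 0) by rewrite rK in K KE; exists K.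
exists (col_base (cokermx B)) => u; rewrite UB submxE -{1}[cokermx B]mulmx_base.
by rewrite mulmxA mulmx_free_eq0 // row_base_free.
Qed.

(** * The Segre variety as a pencil *)

Section Segre.
Variables (F : fieldType) (s : nat).

Definition segre_mx (y : 'rV[F]_2) : 'M[F]_(s, s * 2) :=
  \matrix_i segre_vec (delta_mx 0 i) y.

Lemma mul_segre_mx (x : 'rV_s) y : x *m segre_mx y = segre_vec x y.
Proof.
rewrite mulmx_sum_row {2}[x]row_sum_delta /segre_vec linear_sum mulmx_suml.
rewrite linear_sum; apply: eq_bigr => i _.
by rewrite rowK -[RHS]/(segre_vec _ _) segre_vecZl.
Qed.

Lemma segre_vecDr (x : 'rV[F]_s) (y z : 'rV[F]_2) :
  segre_vec x (y + z) = segre_vec x y + segre_vec x z.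
Proof. by rewrite /segre_vec mulmxDr linearD. Qed.

Lemma segre_mxDZ t (y z : 'rV_2) :
  segre_mx (y + t *: z) = segre_mx y + t *: segre_mx z.
Proof.
apply/row_matrixP=> i; rewrite linearD linearZ /= !rowK.
by rewrite segre_vecDr segre_vecZr.
Qed.

Lemma segre_vec_decomp (v : 'rV[F]_(s * 2)) :
  exists x0 x1, v = segre_vec x0 (delta_mx 0 0) + segre_vec x1 (delta_mx 0 1).
Proof.
exists (col 0 (vec_mx v))^T, (col 1 (vec_mx v))^T.
rewrite /segre_vec -linearD /= -{1}[v]vec_mxK; congr mxvec.
apply/matrixP=> i j; rewrite !mxE !big_ord1 !mxE /=.
have [->|->] : j = 0 \/ j = 1.
  by case: j => -[|[|//]] ?; [left|right]; apply: val_inj.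
all: by rewrite /= ?mulr1 ?mulr0 ?addr0 ?add0r.
Qed.

End Segre.

(** The kernel of the pencil at y is the point of U on F^s (x) y, so it is a
    line and the rank is as large as the r columns permit. *)
Lemma section_pencil_inj (F : fieldType) r (U : {vspace 'rV[F]_(r.+1 * 2)})
    (K : 'M[F]_(r.+1 * 2, r)) (y : 'rV[F]_2) :
    (forall u, (u \in U) = (u *m K == 0)) ->
    (forall W, segreI W -> is_point (U :&: W)%VS) -> y != 0 ->
  forall c : 'cV_r, segre_mx r.+1 y *m K *m c = 0 -> c = 0.
Proof.
move=> UK hmeet y0; set M := _ *m K.
have [W [SW _ Wy]] := segreI_exists r.+1 y0.
have /is_pointP[w w0 UW] := hmeet _ SW.
have [x0 wE] : exists x, w = segre_vec x y.
  apply/Wy; have := memv_line w; rewrite -UW.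
  by apply/subvP/capvSr.
have kerM : (kermx M <= x0)%MS.
  apply/rV_subP => x /sub_kermxP; rewrite mulmxA mul_segre_mx => xK.
  have : segre_vec x y \in (U :&: W)%VS.
    by rewrite memv_cap UK xK eqxx /=; apply/Wy; exists x.
  rewrite UW => /vlineP[k]; rewrite wE -segre_vecZl => xE.
  suff -> : x = k *: x0 by apply: scalemx_sub.
  apply/eqP; rewrite -subr_eq0.
  have : segre_vec (x - k *: x0) y == 0.
    by rewrite -scaleN1r segre_vecDl segre_vecZl xE scaleN1r subrr.
  by rewrite segre_vec_eq0 (negPf y0) orbF.
have fullM : row_full M.
  rewrite /row_full eqn_leq rank_leq_col /=.
  have := leq_trans (mxrankS kerM) (rank_leq_row x0).
  by rewrite mxrank_ker leq_subLR addn1 ltnS.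
move=> c Mc; apply: (row_full_inj fullM).
by rewrite Mc mulmx0.
Qed.

Theorem corollaryA1 (F : closedFieldType) (s : nat) (hs : (0 < s)%N)
    (U : {vspace 'rV[F]_(s * 2)}) (hU : pdim_is s U)
    (hmeet : forall W : {vspace 'rV[F]_(s * 2)},
       segreI W -> is_point (U :&: W)%VS) :
  is_pspan (fun p : {vspace 'rV[F]_(s * 2)} =>
    exists W : {vspace 'rV[F]_(s * 2)}, segreI W /\ p = (U :&: W)%VS) U.
Proof.
split=> [p [W [_ ->]]|Z ZU]; first exact: capvSl.
case: s hs U hU hmeet Z ZU => // r _ U hU hmeet Z ZU.
have [K UK] : exists K : 'M[F]_(r.+1 * 2, r), forall u, (u \in U) = (u *m K == 0).
  by apply: vspace_equations; rewrite hU muln2 -addnn addSnnS.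
have [L ZL] : exists L : 'M[F]_(r.+1 * 2, r.+1 * 2 - \dim Z),
    forall u, (u \in Z) = (u *m L == 0).
  apply: vspace_equations; rewrite subnKC //.
  by have := dimvS (subvf Z); rewrite dimvf /dim /= mul1n.
apply/subvP=> u; rewrite UK ZL => /eqP uK.
pose S (y : 'rV[F]_2) := segre_mx r.+1 y.
pose e0 : 'rV[F]_2 := delta_mx 0 0; pose e1 : 'rV[F]_2 := delta_mx 0 1.
have e1_neq0 : e1 != 0.
  by apply/eqP=> /rowP/(_ 1); rewrite !mxE eqxx => /eqP; rewrite oner_eq0.
have e0t_neq0 t : e0 + t *: e1 != 0.
  apply/eqP=> /rowP/(_ 0); rewrite !mxE eqxx /= mulr0 addr0 => /eqP.
  by rewrite oner_eq0.
apply/eqP/matrixP=> i j; rewrite (ord1 i) [RHS]mxE.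
(* phi is one of the linear forms that define Z. *)
pose phi := col j L.
suff [c [c0 c1]] : exists c : 'cV_r,
    S e0 *m K *m c = S e0 *m phi /\ S e1 *m K *m c = S e1 *m phi.
  have -> : (u *m L) 0 j = (u *m phi) 0 0 by rewrite /phi colE mulmxA -colE [RHS]mxE.
  have [x0 [x1 uE]] := segre_vec_decomp u.
  have -> : u *m phi = u *m K *m c.
    rewrite uE -!mul_segre_mx !mulmxDl -!mulmxA.
    by rewrite -c0 -c1 !mulmxA.
  by rewrite uK mul0mx mxE.
(* The points of PG(1, F) are e1 and the e0 + t e1, whence an affine pencil
   together with its value B at infinity. *)
have S_line t q (Q : 'M[F]_(_, q)) :
    S e0 *m Q + t *: (S e1 *m Q) = S (e0 + t *: e1) *m Q.
  by rewrite /S segre_mxDZ mulmxDl scalemxAl.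
apply: pencil_solution => [t||t x].
- rewrite S_line; exact: section_pencil_inj UK hmeet (e0t_neq0 t).
- exact: section_pencil_inj UK hmeet e1_neq0.
- rewrite !S_line !mulmxA mul_segre_mx => xK.
  have [W [SW _ Wy]] := segreI_exists r.+1 (e0t_neq0 t).
  have /subvP/(_ (segre_vec x (e0 + t *: e1))) :=
    ZU _ (ex_intro _ W (conj SW erefl)).
  rewrite memv_cap UK xK eqxx ZL /= => /(_ _)/eqP xL.
  rewrite /phi colE mulmxA xL ?mul0mx //.
  by apply/Wy; exists x.
Qed.
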